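(* Let $\varepsilon>0$, $C,A_1,\dots,A_M\in\mathbb S^N$ and $b_1,\dots,b_M\in\mathbb R$, and assume $-I_N\preceq C\preceq I_N$ and $-I_N\preceq A_i\preceq I_N$ for $i=1,\dots,M$. Assume that the semidefinite program $$\lambda^\star=\inf\{\operatorname{tr}(CX): X\in\mathbb S^N_+,\ \operatorname{tr}(X)=1,\ \operatorname{tr}(A_iX)=b_i,\ i=1,\dots,M\}$$ has an optimal solution, let $\lambda^\star$ be its optimal value, and let $\lambda_{\min},\lambda_{\max}\in\mathbb R$ be such that $\lambda^\star\in[\lambda_{\min},\lambda_{\max}]$. Further, assume that $$\lambda^\star=\inf\{\operatorname{tr}(CX): X\in\mathbb S^N_+,\ \operatorname{tr}(A_iX)=b_i,\ i=1,\dots,M\},$$ and that strong duality holds for this last problem and its dual $\sup\{b^\top\xi:\ \xi\in\mathbb R^M,\ C-\sum_{i=1}^M\xi_iA_i\succeq0\}$, which admits a solution $\xi^\star$. Let $\underline\lambda_T$ be the value returned by the binary search algorithm BS (described in the context). Then $$0\le\lambda^\star-\underline\lambda_T\le\varepsilon\,(2+\|\xi^\star\|_{\ell_1}).$$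
   Context: $\mathbb S^N$ (resp. $\mathbb S^N_+$) is the set of real symmetric (resp. positive semidefinite) $N\times N$ matrices, $b=(b_1,\dots,b_M)$. Strong duality means that the primal and dual optimal values are equal and both are attained. Hamiltonian updates HU. Input: $\varepsilon>0$, $A'_1,\dots,A'_{M'}\in\mathbb S^N$, $b'_1,\dots,b'_{M'}\in\mathbb R$ (encoding: find $X\succeq0$ with $\operatorname{tr}X=1$, $\operatorname{tr}(A'_jX)\le b'_j$ for all $j$). Set $W^{(1)}=I_N$ and $T'=\lceil 16\log(N)/\varepsilon^2\rceil$. For $t=1,\dots,T'$: set $P^{(t)}=W^{(t)}/\operatorname{tr}(W^{(t)})$; if some $j^{(t)}$ satisfies $\operatorname{tr}(A'_{j^{(t)}}P^{(t)})>b'_{j^{(t)}}+\varepsilon$, choose one and set $M^{(t)}=\frac12(I_N-A'_{j^{(t)}})$; otherwise stop with output $\eta=1$. Set $W^{(t+1)}=\exp\big(\frac{\varepsilon}{4}\sum_{s=1}^tM^{(s)}\big)$. If the loop completes, output $\eta=0$. Binary search BS. Input: $C,A_i,b_i$, reals $\lambda_{\min}<\lambda_{\max}$, $\varepsilon>0$. Set $\underline\lambda_0=\lambda_{\min}$, $\overline\lambda_0=\lambda_{\max}$, $T=\lceil\log_2((\lambda_{\max}-\lambda_{\min})/\varepsilon)\rceil$. For $t=0,\dots,T-1$: let $\lambda_t=(\underline\lambda_t+\overline\lambda_t)/2$; run HU with accuracy $\varepsilon$ on the constraints $\operatorname{tr}(A_iX)\le b_i$, $\operatorname{tr}(-A_iX)\le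 -b_i$ ($i=1,\dots,M$), $\operatorname{tr}(CX)\le\lambda_t$; if $\eta=0$ set $(\underline\lambda_{t+1},\overline\lambda_{t+1})=(\lambda_t,\overline\lambda_t)$, if $\eta=1$ set $(\underline\lambda_{t+1},\overline\lambda_{t+1})=(\underline\lambda_t,\lambda_t)$. Output: the final lower value $\underline\lambda_T$.
   Formalization: The formal theorem assumes N ≥ 2; for N = 1 the claim fails as stated, since log N = 0 makes HU run no iterations and always output η = 0 (e.g. C = 0, no constraints, λmin = −1, λmax = 3, ε = 2 gives the returned value 1 > λ* = 0). *)

(* Defs.v *)
From HB Require Import structures.
From mathcomp Require Import all_boot all_order all_algebra.
From mathcomp Require Import all_classical all_reals all_analysis.

Set Implicit Arguments.
Unset Strict Implicit.
Unset Printing Implicit Defensive.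

Import Order.TTheory GRing.Theory Num.Theory.
Import numFieldNormedType.Exports.

Local Open Scope classical_set_scope.
Local Open Scope ring_scope.

Section Matrices.
Variables (R : realType) (N : nat).

Definition psdmx (X : 'M[R]_N) : Prop :=
  X \is symmetricmx /\ forall v : 'cV[R]_N, 0 <= (v^T *m X *m v) 0 0.

Definition loewner_le (X Y : 'M[R]_N) : Prop := psdmx (Y - X).

(* The limit is taken in the norm topology of 'M[R]_N. *)
Definition expmx (X : 'M[R]_N) : 'M[R]_N :=
  limn (series (fun k : nat => (k`!%:R^-1 : R) *: X ^+ k)).

End Matrices.

Definition norm1 (R : realType) (M : nat) (xi : 'cV[R]_M) : R :=
  \sum_i `|xi i 0|.

Section SemidefiniteProgram.
Variables (R : realType) (N M : nat).
Variables (C : 'M[R]_N) (A : 'I_M -> 'M[R]_N) (b : 'cV[R]_M).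

Definition primal_feasible : set 'M[R]_N :=
  [set X | psdmx X /\ forall i, \tr (A i *m X) = b i 0].

Definition primal_feasible_tr1 : set 'M[R]_N :=
  [set X | primal_feasible X /\ \tr X = 1].

Definition dual_feasible : set 'cV[R]_M :=
  [set xi | psdmx (C - \sum_i xi i 0 *: A i)].

(* Optimal values live in the extended reals, so that infeasible and unbounded
   problems get the usual values +oo and -oo. *)
Definition min_value (F : set 'M[R]_N) : \bar R :=
  ereal_inf [set (\tr (C *m X))%:E | X in F].

Definition min_solution (F : set 'M[R]_N) (X : 'M[R]_N) : Prop :=
  F X /\ (\tr (C *m X))%:E = min_value F.

Definition dual_value : \bar R :=
  ereal_sup [set ((b^T *m xi) 0 0)%:E | xi in dual_feasible].

Definition dual_solution (xi : 'cV[R]_M) : Prop :=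
  dual_feasible xi /\ ((b^T *m xi) 0 0)%:E = dual_value.

Definition strong_duality : Prop :=
  [/\ min_value primal_feasible = dual_value,
      exists X, min_solution primal_feasible X &
      exists xi, dual_solution xi].

End SemidefiniteProgram.

(* The number of passes of a loop whose bound is the ceiling of x: it is 0 when
   that ceiling is negative. *)
Definition loop_count (R : realType) (x : R) : nat :=
  absz (Num.max 0 (Num.ceil x)).

Section HamiltonianUpdates.
Variables (R : realType) (N : nat) (eps : R).

(* A pair (A', b') stands for the constraint tr(A' X) <= b'. *)
Variable cs : seq ('M[R]_N * R).

Definition violated (c : 'M[R]_N * R) (P : 'M[R]_N) : Prop :=
  c.2 + eps < \tr (c.1 *m P).

Definition normalize_tr (W : 'M[R]_N) : 'M[R]_N := (\tr W)^-1 *: W.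

(* [hu_run n W S eta]: with n iterations left, current weight matrix W and
   S the sum of the matrices M^(s) of the past iterations, the loop may output
   eta.  It is a relation because the violated constraint is chosen freely. *)
Inductive hu_run : nat -> 'M[R]_N -> 'M[R]_N -> bool -> Prop :=
| hu_complete W S : hu_run 0 W S false
| hu_stop n W S :
    (forall c, c \in cs -> ~ violated c (normalize_tr W)) ->
    hu_run n.+1 W S true
| hu_update n W S c eta :
    c \in cs -> violated c (normalize_tr W) ->
    let S' := S + 2^-1 *: (1%:M - c.1) in
    hu_run n (expmx ((eps / 4) *: S')) S' eta ->
    hu_run n.+1 W S eta.

Definition hamiltonian_updates (eta : bool) : Prop :=
  hu_run (loop_count (16 * ln N%:R / eps ^+ 2)) 1%:M 0 eta.

End HamiltonianUpdates.

Section BinarySearch.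
Variables (R : realType) (N M : nat) (eps : R).
Variables (C : 'M[R]_N) (A : 'I_M -> 'M[R]_N) (b : 'cV[R]_M).

Definition bs_constraints (lambda : R) : seq ('M[R]_N * R) :=
  [seq (A i, b i 0) | i <- enum 'I_M] ++
  [seq (- A i, - b i 0) | i <- enum 'I_M] ++
  [:: (C, lambda)].

(* [bs_run n lo hi out]: with n iterations left and current interval [lo, hi],
   the search may return out; each call to HU may make its own choices. *)
Inductive bs_run : nat -> R -> R -> R -> Prop :=
| bs_return lo hi : bs_run 0 lo hi lo
| bs_iter n lo hi eta out :
    let mid := (lo + hi) / 2 in
    hamiltonian_updates eps (bs_constraints mid) eta ->
    bs_run n (if eta then lo else mid) (if eta then mid else hi) out ->
    bs_run n.+1 lo hi out.

Definition binary_search (lmin lmax out : R) : Prop :=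
  bs_run (loop_count (ln ((lmax - lmin) / eps) / ln 2)) lmin lmax out.

End BinarySearch.

(* Main.v *)
Require Import Defs.
From HB Require Import structures.
From mathcomp Require Import all_boot all_order all_algebra.
From mathcomp Require Import all_classical all_reals all_analysis.
From mathcomp Require Import ring lra.

Set Implicit Arguments.
Unset Strict Implicit.
Unset Printing Implicit Defensive.

Import Order.TTheory GRing.Theory Num.Theory.
Import numFieldNormedType.Exports.

Local Open Scope classical_set_scope.
Local Open Scope ring_scope.

(* Each call to Hamiltonian updates is analysed by the matrix multiplicative
   weights argument, with step h = eps / 4.  By Golden-Thompson and
   e^(hM) <= 1 + (e^h - 1) M for 0 <= M <= 1, the trace of the weight W is
   multiplied by at most exp((e^h - 1) tr(M P)) at each update, while
   tr(exp H) >= exp(tr(H X)) for every density matrix X.  If X is feasible, each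
   update has tr(M X) > tr(M P) + eps / 2, so that fewer than 16 log N / eps^2
   updates are possible: a completed loop certifies lambda < lambda*.  If instead
   the loop stops, P is feasible up to eps, and pairing it with
   C - sum_i xi_i A_i >= 0 gives lambda* <= lambda + eps (1 + |xi|_1).  These two
   facts bound lambda* throughout the binary search.

   All the spectral inputs are obtained without diagonalization, from the
   approximations (1 + H/n + E/n^2)^n -> exp H along n = 2^k: Golden-Thompson
   reduces to tr((XY)^n) <= tr(X^n Y^n) for symmetric X and Y, which follows by
   induction on k from tr(Z^2) <= tr(Z Z^T). *)

(** * Positive semidefinite matrices and trace inequalities *)

Lemma symmetricmxP (R : fieldType) n (X : 'M[R]_n) :
  reflect (X^T = X) (X \is symmetricmx).
Proof.
apply: (iffP idP) => [/is_hermitianmxP | XT].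
  by rewrite expr0 scale1r map_mx_id.
by apply/is_hermitianmxP; rewrite expr0 scale1r map_mx_id.
Qed.

Section SquareMatrices.
Variables (R : realType) (N : nat).
Implicit Types X Y Z M P : 'M[R]_N.

Lemma trmxX X k : (X ^+ k)^T = X^T ^+ k.
Proof.
elim: k => [|k IHk]; first by rewrite !expr0 trmx1.
by rewrite exprSr exprS [LHS]trmx_mul IHk.
Qed.

Lemma exprZmx (a : R) X k : (a *: X) ^+ k = a ^+ k *: X ^+ k.
Proof.
elim: k => [|k IHk]; first by rewrite !expr0 scale1r.
rewrite !exprS IHk -[LHS]/((a *: X) *m (a ^+ k *: X ^+ k)).
by rewrite -scalemxAl -scalemxAr scalerA.
Qed.

Lemma psdmx_sym X : psdmx X -> X^T = X.
Proof. by case=> /symmetricmxP. Qed.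

Lemma psdmx_form X (v : 'cV[R]_N) : psdmx X -> 0 <= (v^T *m X *m v) 0 0.
Proof. by case. Qed.

Lemma psdmxI X : X^T = X -> (forall v : 'cV[R]_N, 0 <= (v^T *m X *m v) 0 0) ->
  psdmx X.
Proof. by move=> XT X0; split=> //; apply/symmetricmxP. Qed.

Lemma psdmx0 : psdmx (0 : 'M[R]_N).
Proof.
by apply: psdmxI => [|v]; [rewrite trmx0 | rewrite mulmx0 mul0mx mxE].
Qed.

Lemma psdmxD X Y : psdmx X -> psdmx Y -> psdmx (X + Y).
Proof.
move=> pX pY; apply: psdmxI => [|v].
  by rewrite linearD /= (psdmx_sym pX) (psdmx_sym pY).
by rewrite mulmxDr mulmxDl mxE addr_ge0// psdmx_form.
Qed.

Lemma psdmxZ a X : 0 <= a -> psdmx X -> psdmx (a *: X).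
Proof.
move=> a0 pX; apply: psdmxI => [|v]; first by rewrite linearZ /= (psdmx_sym pX).
by rewrite -scalemxAr -scalemxAl mxE mulr_ge0// psdmx_form.
Qed.

Lemma psdmx_sum (I : Type) (r : seq I) (F : I -> 'M[R]_N) :
  (forall i, psdmx (F i)) -> psdmx (\sum_(i <- r) F i).
Proof. by move=> pF; apply: big_ind => //; [exact: psdmx0 | exact: psdmxD]. Qed.

Lemma psdmx_congr X Z : psdmx X -> psdmx (Z^T *m X *m Z).
Proof.
move=> pX; apply: psdmxI => [|v];
  first by rewrite !trmx_mul trmxK (psdmx_sym pX) mulmxA.
by have := psdmx_form (Z *m v) pX; rewrite trmx_mul !mulmxA.
Qed.

Lemma psdmx_trace_ge0 X : psdmx X -> 0 <= \tr X.
Proof.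
move=> pX; apply: sumr_ge0 => i _.
have := psdmx_form (delta_mx i 0) pX.
by rewrite trmx_delta -rowE -colE !mxE.
Qed.

Lemma mxtrace_psd_gram X Z : psdmx X -> 0 <= \tr (Z *m Z^T *m X).
Proof.
move=> pX; rewrite -mulmxA mxtrace_mulC.
exact/psdmx_trace_ge0/psdmx_congr.
Qed.

Lemma psdmx_gram Z : psdmx (Z^T *m Z).
Proof.
have p1 : psdmx (1%:M : 'M[R]_N).
  apply: psdmxI => [|v]; first by rewrite trmx1.
  rewrite mulmx1 mxE; apply: sumr_ge0 => i _; rewrite mxE -expr2.
  exact: sqr_ge0.
by have := psdmx_congr Z p1; rewrite mulmx1.
Qed.

Lemma psdmx1 : psdmx (1%:M : 'M[R]_N).
Proof. by have := psdmx_gram 1%:M; rewrite trmx1 mulmx1. Qed.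

(* For a symmetric 0 <= X, summing the values of the form of X at the vectors
   v_j e_i - v_i e_j gives twice the value at v of the form of (tr X) I - X. *)
Lemma psdmx_le_trace X : psdmx X -> psdmx ((\tr X)%:M - X).
Proof.
move=> pX; apply: psdmxI => [|v].
  by rewrite linearB /= tr_scalar_mx (psdmx_sym pX).
have XT i j : X i j = X j i by rewrite -[in LHS](psdmx_sym pX) mxE.
have form_eq (Y : 'M[R]_N) (u : 'cV[R]_N) :
    (u^T *m Y *m u) 0 0 = \sum_i \sum_j u i 0 * Y i j * u j 0.
  rewrite mxE exchange_big /=; apply: eq_bigr => i _.
  by rewrite mxE big_distrl /=; apply: eq_bigr => j _; rewrite !mxE.
suff -> : (v^T *m ((\tr X)%:M - X) *m v) 0 0 = 2^-1 * \sum_i \sum_j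
    (X i i * v j 0 ^+ 2 + X j j * v i 0 ^+ 2 - 2 * X i j * v i 0 * v j 0).
  apply: mulr_ge0; first by rewrite invr_ge0.
  apply: sumr_ge0 => i _; apply: sumr_ge0 => j _.
  have := psdmx_form (v j 0 *: delta_mx i 0 - v i 0 *: delta_mx j 0) pX.
  rewrite [(_ - _)^T]linearB /= ![(_ *: _)^T]linearZ /= !trmx_delta.
  rewrite !(mulmxBl, mulmxBr) -!(scalemxAl, scalemxAr) -!rowE -!colE !mxE.
  by rewrite (XT j i); lra.
have Sii : \sum_i \sum_j (X i i * v j 0 ^+ 2) = \tr X * \sum_j v j 0 ^+ 2.
  by rewrite big_distrl /=; apply: eq_bigr => i _; rewrite big_distrr.
have Sjj : \sum_i \sum_j (X j j * v i 0 ^+ 2) = \tr X * \sum_j v j 0 ^+ 2.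
  by rewrite exchange_big /= Sii.
have Sij : \sum_i \sum_j (2 * X i j * v i 0 * v j 0) = 2 * (v^T *m X *m v) 0 0.
  rewrite form_eq big_distrr /=; apply: eq_bigr => i _.
  by rewrite big_distrr /=; apply: eq_bigr => j _; ring.
under eq_bigr do rewrite big_split sumrN big_split /=.
rewrite big_split sumrN big_split /= Sii Sjj Sij mulmxBr mulmxBl.
rewrite [LHS]mxE [X in _ + X]mxE mul_mx_scalar -scalemxAl mxE.
have -> : (v^T *m v) 0 0 = \sum_j v j 0 ^+ 2.
  by rewrite mxE; apply: eq_bigr => j _; rewrite mxE expr2.
by field.
Qed.

(** Pair [Z *m Z^T] with (tr X) I - X, which is positive semidefinite. *)
Lemma mxtrace_gram_le X Z : psdmx X ->
  \tr (Z *m Z^T *m X) <= \tr (Z *m Z^T) * \tr X.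
Proof.
move=> /psdmx_le_trace/(mxtrace_psd_gram Z).
by rewrite mulmxBr linearB /= mul_mx_scalar linearZ /= subr_ge0 mulrC.
Qed.

(** Conjugating by [M ^+ k./2] reduces to the exponents 0 and 1. There the difference is [1%:M - M],
    or [M - M ^+ 2], a sum of congruences of [1%:M - M] and [M]. *)
Lemma psdmx_power_step M k : psdmx M -> psdmx (1%:M - M) ->
  psdmx (M ^+ k - M ^+ k.+1).
Proof.
move=> pM pM1; have MT := psdmx_sym pM.
have MkT i : (M ^+ i)^T = M ^+ i by rewrite trmxX MT.
have base1 : psdmx (M - M ^+ 2).
  have -> : M - M ^+ 2 = M^T *m (1%:M - M) *m M + (1%:M - M)^T *m M *m
    (1%:M - M).
    rewrite [(1%:M - M)^T]linearB /= trmx1 MT.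
    rewrite !(mulmxBl, mulmxBr, mulmx1, mul1mx) -mulmxA expr2 -[M * M]/(M *m M).
    set t := M *m (M *m M); set q := M *m M.
    by apply/matrixP => i j; rewrite !mxE; ring.
  exact: psdmxD (psdmx_congr _ pM1) (psdmx_congr _ pM).
have shift i j : M ^+ (i + j + i) - M ^+ (i + j + i).+1 =
    (M ^+ i)^T *m (M ^+ j - M ^+ j.+1) *m M ^+ i.
  rewrite MkT -[RHS]/(M ^+ i * (M ^+ j - M ^+ j.+1) * M ^+ i).
  by rewrite mulrBr mulrBl -!exprD addnS addSn.
have -> : k = (k./2 + odd k + k./2)%N by rewrite addnAC addnn addnC
  odd_double_half.
rewrite shift; apply: psdmx_congr.
by case: (odd k); rewrite ?expr1 ?expr0 //.
Qed.

Lemma psdmx_power M k : psdmx M -> psdmx (1%:M - M) -> psdmx (M - M ^+ k.+1).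
Proof.
move=> pM pM1; elim: k => [|k IHk]; first by rewrite expr1 subrr; exact: psdmx0.
have -> : M - M ^+ k.+2 = (M - M ^+ k.+1) + (M ^+ k.+1 - M ^+ k.+2).
  by rewrite addrA subrK.
exact: psdmxD IHk (psdmx_power_step _ _ _).
Qed.

(** Finite form of e^(hM) <= 1 + (e^h - 1) M: in the binomial expansion each power [M ^+ i.+1] is
    bounded by [M], with a nonnegative coefficient. *)
Lemma psdmx_binomial M (x : R) n : psdmx M -> psdmx (1%:M - M) -> 0 <= x ->
  psdmx (1%:M + ((1 + x) ^+ n - 1) *: M - (1%:M + x *: M) ^+ n).
Proof.
move=> pM pM1 x0.
have -> : 1%:M + ((1 + x) ^+ n - 1) *: M - (1%:M + x *: M) ^+ n =
    \sum_(i < n) (x ^+ i.+1 *+ 'C(n, i.+1)) *: (M - M ^+ i.+1).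
  rewrite [1%:M + x *: M]addrC -[1%:M]/(1 : 'M[R]_N) exprD1n big_ord_recl.
  rewrite expr0 bin0 mulr1n [in (1 + x) ^+ n]addrC exprD1n big_ord_recl.
  rewrite expr0 bin0 mulr1n [1 + \sum_(_ < _) _ - 1]addrC addKr.
  rewrite opprD addrACA subrr add0r scaler_suml -sumrB.
  apply: eq_bigr => i _; rewrite scalerBr exprZmx scalerMnl.
  by [].
apply: psdmx_sum => i; apply: psdmxZ; first by rewrite mulrn_wge0// exprn_ge0.
exact: psdmx_power.
Qed.

(** The squared Frobenius norm of [X - X^T] is nonnegative. *)
Lemma mxtrace_sqr_le X : \tr (X *m X) <= \tr (X *m X^T).
Proof.
have := psdmx_trace_ge0 (psdmx_gram (X - X^T)).
rewrite [(X - X^T)^T]linearB /= trmxK mulmxBl !mulmxBr !raddfB /=.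
rewrite -(mxtrace_tr (X^T *m X^T)) trmx_mul trmxK (mxtrace_mulC X^T X).
lra.
Qed.

Lemma mxtrace_mul_le_sqr X Y : X^T = X -> Y^T = Y ->
  2 * \tr (X *m Y) <= \tr (X *m X) + \tr (Y *m Y).
Proof.
move=> XT YT; have := psdmx_trace_ge0 (psdmx_gram (X - Y)).
rewrite [(X - Y)^T]linearB /= XT YT mulmxBl !mulmxBr !raddfB /=
  (mxtrace_mulC Y X).
lra.
Qed.

Lemma mxtrace_exp_mulC X Y k : \tr ((X *m Y) ^+ k) = \tr ((Y *m X) ^+ k).
Proof.
case: k => [|k]; first by rewrite !expr0.
have swap j : X * (Y * X) ^+ j = (X * Y) ^+ j * X.
  elim: j => [|j IHj]; first by rewrite !expr0 mulr1 mul1r.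
  by rewrite !exprS -mulrA !mulrA -[LHS]mulrA IHj mulrA.
rewrite -![_ *m _]/(_ * _) exprSr mulrA -swap.
by rewrite -[_ * _ * Y]/((X * _) *m Y) mxtrace_mulC exprS -mulrA.
Qed.

(** Each inequality feeds the induction of the other. At [k.+1], the first follows from the second
    at [k] for [X *m Y], then the first at [k] for the squares of [X] and [Y]. *)
Lemma mxtrace_exp2_le k :
  (forall X Y, X^T = X -> Y^T = Y ->
     \tr ((X *m Y) ^+ (2 ^ k)) <= \tr (X ^+ (2 ^ k) *m Y ^+ (2 ^ k))) /\
  (forall Z, \tr (Z ^+ (2 ^ k.+1)) <= \tr ((Z *m Z^T) ^+ (2 ^ k))).
Proof.
elim: k => [|k [IHXY IHZ]].
  by split=> [X Y _ _|Z]; rewrite ?expr1 ?expr2 //; exact: mxtrace_sqr_le.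
have sq2 (Z : 'M[R]_N) : Z ^+ (2 ^ k.+1) = (Z *m Z) ^+ (2 ^ k).
  by rewrite expnS exprM expr2.
have XYle X Y : X^T = X -> Y^T = Y ->
     \tr ((X *m Y) ^+ (2 ^ k.+1)) <= \tr (X ^+ (2 ^ k.+1) *m Y ^+ (2 ^ k.+1)).
  move=> XT YT; apply: le_trans (IHZ _) _.
  rewrite trmx_mul XT YT -!mulmxA mxtrace_exp_mulC -!mulmxA mulmxA !sq2
    mxtrace_exp_mulC.
  by apply: IHXY; rewrite trmx_mul ?XT ?YT.
split=> // Z.
rewrite expnS exprM; apply: le_trans (IHZ _) _.
rewrite expr2 -[Z * Z]/(Z *m Z) trmx_mul -!mulmxA mxtrace_exp_mulC.
rewrite -!mulmxA mulmxA mxtrace_exp_mulC.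
(* Up to cyclic permutation the trace is now that of (XY)^(2^k). The first inequality separates the
   factors, and 2 tr(PQ) <= tr(P^2) + tr(Q^2) concludes, since powers of [X] and [Y] have equal
   traces. *)
set X := Z *m Z^T; set Y := Z^T *m Z.
have XT : X^T = X by rewrite trmx_mul trmxK.
have YT : Y^T = Y by rewrite trmx_mul trmxK.
rewrite mxtrace_exp_mulC; apply: le_trans (IHXY _ _ XT YT) _.
have XnT j : (X ^+ j)^T = X ^+ j by rewrite trmxX XT.
have YnT j : (Y ^+ j)^T = Y ^+ j by rewrite trmxX YT.
have := mxtrace_mul_le_sqr (XnT (2 ^ k)%N) (YnT (2 ^ k)%N).
have sq (P : 'M[R]_N) : P ^+ (2 ^ k) *m P ^+ (2 ^ k) = P ^+ (2 ^ k.+1).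
  by rewrite -[_ *m _]/(_ * _) -exprD addnn -mul2n -expnS.
rewrite !sq.
have <- : \tr (X ^+ (2 ^ k.+1)) = \tr (Y ^+ (2 ^ k.+1)) by rewrite
  mxtrace_exp_mulC.
lra.
Qed.

(** Jensen's inequality by repeated squaring: the variance tr((P - t)^2 X) at t = tr(PX) is
    nonnegative, so tr(PX)^2 <= tr(P^2 X). *)
Lemma mxtrace_exp_density X Y k : Y^T = Y -> psdmx X -> \tr X = 1 ->
  0 <= \tr (Y *m X) ->
  \tr (Y *m X) ^+ (2 ^ k) <= \tr (Y ^+ (2 ^ k) *m X).
Proof.
move=> YT pX X1 YX0; elim: k => [|k IHk]; first by rewrite expr1.
have YkT : (Y ^+ (2 ^ k))^T = Y ^+ (2 ^ k) by rewrite trmxX YT.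
set P := Y ^+ (2 ^ k) in IHk YkT.
rewrite expnSr !exprM -/P; apply: (@le_trans _ _ (\tr (P *m X) ^+ 2)).
  by rewrite lerXn2r// nnegrE ?exprn_ge0// (le_trans _ IHk)// exprn_ge0.
set t := \tr (P *m X).
have := mxtrace_psd_gram (P - t%:M) pX.
rewrite [(P - _)^T]linearB /= tr_scalar_mx YkT !(mulmxBl, mulmxBr)
  mul_mx_scalar !mul_scalar_mx.
rewrite -scalemxAl -!scalemxAl.
rewrite !linearB /= !linearZ /= mul_scalar_mx linearZ /= X1 -/t.
rewrite -[P ^+ 2]/(P *m P) -![_ *: _]/(_ * _).
lra.
Qed.

End SquareMatrices.

(** * Euler approximation of the matrix exponential *)

Section ScalarExponential.
Variable R : realType.
Implicit Types x g e : R.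

Lemma exp_partial_sum_le n g : 0 <= g ->
  \sum_(i < n) (i`!%:R^-1 * g ^+ i) <= expR g.
Proof.
move=> g0; have -> : \sum_(i < n) (i`!%:R^-1 * g ^+ i) = series (exp_coeff g) n.
  by rewrite seriesEord /=; apply: eq_bigr => i _; rewrite mulrC.
apply: nondecreasing_cvgn_le; last exact: is_cvg_series_exp_coeff.
apply/nondecreasing_seqP => k; rewrite seriesSr lerDl.
exact: exp_coeff_ge0.
Qed.

Lemma expR_ge_euler n x : 0 <= x -> (1 + x) ^+ n <= expR (n%:R * x).
Proof.
move=> x0; rewrite expRM_natl lerXn2r ?expR_ge1Dx// nnegrE ?expR_ge0//.
by rewrite addr_ge0.
Qed.

(** For y = x / (1 + x), the bound e^(-y) >= 1 - y = 1 / (1 + x) inverts to e^y <= 1 + x. *)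
Lemma expR_le_euler n x : 0 <= x -> expR (n%:R * (x / (1 + x))) <= (1 + x) ^+ n.
Proof.
move=> x0; have x1 : 0 < 1 + x by rewrite ltr_wpDr.
rewrite expRM_natl lerXn2r// ?nnegrE ?expR_ge0 ?(ltW x1)//.
rewrite -[leLHS]invrK -expRN invf_ple ?posrE ?expR_gt0//.
apply: le_trans (expR_ge1Dx _); rewrite le_eqVlt; apply/orP; left; apply/eqP.
by field; rewrite gt_eqF.
Qed.

(** The coefficients of the exponential series dominate those of (1 + x/n)^n, because a falling
    factorial is at most the power. *)
Lemma bin_le_invfact n k : 'C(n, k)%:R * (n%:R^-1 : R) ^+ k <= k`!%:R^-1.
Proof.
case: n => [|n].
  by case: k => [|k]; rewrite ?bin0 ?fact0 ?expr0 ?invr1 ?mulr1// bin0n mul0r invr_ge0.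
have ffle : (n.+1 ^_ k <= n.+1 ^ k)%N.
  elim: k => // k IHk; rewrite ffactnSr expnSr leq_mul//; exact: leq_subr.
rewrite exprVn ler_pdivrMr ?exprn_gt0// mulrC ler_pdivlMr ?ltr0n ?fact_gt0//.
by rewrite -natrM bin_ffact -natrX ler_nat.
Qed.

End ScalarExponential.

(** * Row-sum bounds and majorants of matrix polynomials *)

Section RowSumBound.
Variables (R : realType) (N : nat).
Implicit Types (X Y D G E : 'M[R]_N) (x y d g e : R).

(** A bound on the operator norm induced by the sup norm, hence submultiplicative. As a relation, it
    lets a matrix expression be majorized by the same expression in scalars. *)
Definition rowsum_le X x := forall i, \sum_j `|X i j| <= x.

Lemma rowsum_le_ex X : exists2 x, 0 <= x & rowsum_le X x.
Proof.
exists (\sum_i \sum_j `|X i j|) => [|i].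
  by apply: sumr_ge0 => i _; apply: sumr_ge0.
rewrite [leRHS](bigD1 i) //= lerDl; apply: sumr_ge0 => k _; exact: sumr_ge0.
Qed.

Lemma rowsum_le_entry X x i j : rowsum_le X x -> `|X i j| <= x.
Proof.
move=> Xx; apply: le_trans (Xx i); rewrite (bigD1 j) //= lerDl.
exact: sumr_ge0.
Qed.

Lemma rowsum_leD X Y x y : rowsum_le X x -> rowsum_le Y y ->
  rowsum_le (X + Y) (x + y).
Proof.
move=> Xx Yy i; apply: le_trans (lerD (Xx i) (Yy i)); rewrite -big_split /=.
by apply: ler_sum => j _; rewrite mxE ler_normD.
Qed.

Lemma rowsum_leZ a X x : rowsum_le X x -> rowsum_le (a *: X) (`|a| * x).
Proof.
move=> Xx i; apply: le_trans (ler_wpM2l (normr_ge0 a) (Xx i)).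
by rewrite mulr_sumr; apply: ler_sum => j _; rewrite mxE normrM.
Qed.

Lemma rowsum_le0 : rowsum_le 0 0.
Proof. by move=> i; rewrite big1// => j _; rewrite mxE normr0. Qed.

Lemma rowsum_le1 : rowsum_le 1%:M 1.
Proof.
move=> i; rewrite (bigD1 i) //= mxE eqxx normr1 big1 ?addr0// => j ji.
by rewrite mxE eq_sym (negbTE ji) normr0.
Qed.

Lemma rowsum_leM X Y x y : 0 <= y -> rowsum_le X x -> rowsum_le Y y ->
  rowsum_le (X *m Y) (x * y).
Proof.
move=> y0 Xx Yy i; apply: le_trans (ler_wpM2r y0 (Xx i)).
apply: (@le_trans _ _ (\sum_j \sum_k `|X i k| * `|Y k j|)).
  apply: ler_sum => j _; rewrite mxE; apply: le_trans (ler_norm_sum _ _ _) _.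
  by apply: ler_sum => k _; rewrite normrM.
rewrite exchange_big mulr_suml /=; apply: ler_sum => k _.
by rewrite -mulr_sumr ler_wpM2l.
Qed.

Lemma rowsum_leX X x k : 0 <= x -> rowsum_le X x -> rowsum_le (X ^+ k) (x ^+ k).
Proof.
move=> x0 Xx; elim: k => [|k IHk]; first by rewrite !expr0; exact: rowsum_le1.
by rewrite !exprS; apply: rowsum_leM => //; rewrite exprn_ge0.
Qed.

Lemma rowsum_le_sum (I : Type) (r : seq I) (F : I -> 'M[R]_N) (f : I -> R) :
  (forall i, rowsum_le (F i) (f i)) ->
  rowsum_le (\sum_(i <- r) F i) (\sum_(i <- r) f i).
Proof.
by move=> Ff; apply: (big_ind2 rowsum_le) => //;
  [exact: rowsum_le0 | move=> *; exact: rowsum_leD].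
Qed.

(** Matrices and scalars obey the same recursion, in which only sums and products of majorized terms
    occur. *)
Lemma rowsum_le_expB X D x d k : 0 <= x -> 0 <= d ->
  rowsum_le X x -> rowsum_le D d ->
  rowsum_le ((X + D) ^+ k - X ^+ k) ((x + d) ^+ k - x ^+ k).
Proof.
move=> x0 d0 Xx Dd; elim: k => [|k IHk].
  by rewrite !expr0 !subrr; exact: rowsum_le0.
have -> : (X + D) ^+ k.+1 - X ^+ k.+1 =
    ((X + D) ^+ k - X ^+ k) * (X + D) + X ^+ k * D.
  by rewrite !exprSr mulrBl [X ^+ k * (_ + _)]mulrDr opprD addrA subrK.
have -> : (x + d) ^+ k.+1 - x ^+ k.+1 =
    ((x + d) ^+ k - x ^+ k) * (x + d) + x ^+ k * d.
  by rewrite !exprSr; ring.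
apply: rowsum_leD; apply: rowsum_leM => //; first exact: addr_ge0.
- exact: rowsum_leD.
- exact: rowsum_leX.
Qed.

Lemma rowsum_le_euler_series G g n : 0 <= g -> rowsum_le G g ->
  rowsum_le (\sum_(i < n.+1) (i`!%:R^-1 *: G ^+ i) - (1 + n%:R^-1 *: G) ^+ n)
            (\sum_(i < n.+1) (i`!%:R^-1 * g ^+ i) - (1 + n%:R^-1 * g) ^+ n).
Proof.
move=> g0 Gg; rewrite ![1 + _]addrC !exprD1n -!sumrB; apply: rowsum_le_sum => i.
rewrite exprZmx scalerMnl exprMn -mulrnAl -scalerBl -mulrBl.
set c := _ - _; have c0 : 0 <= c by rewrite subr_ge0 -mulr_natl bin_le_invfact.
have := rowsum_leZ c (rowsum_leX (i : nat) g0 Gg).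
by rewrite ger0_norm.
Qed.

(* The deviation is majorized by the same expression in the row-sum bounds,
   because all the coefficients of its expansion in G and E are nonnegative. *)
Lemma euler_entry_dist G E g e n i j : (0 < n)%N -> 0 <= g -> 0 <= e ->
  rowsum_le G g -> rowsum_le E e ->
  `|(\sum_(k < n.+1) (k`!%:R^-1 *: G ^+ k)) i j -
    ((1 + n%:R^-1 *: G + n%:R^-1 ^+ 2 *: E) ^+ n) i j| <=
  expR (g + n%:R^-1 * e) + expR g - 2 * expR (g / (1 + n%:R^-1 * g)).
Proof.
move=> n0 g0 e0 Gg Ee; have nR : (n%:R : R) != 0 by rewrite pnatr_eq0 -lt0n.
have in0 : 0 <= (n%:R : R)^-1 by rewrite invr_ge0.
have ing : 0 <= n%:R^-1 * g by rewrite mulr_ge0.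
have ie : 0 <= n%:R^-1 ^+ 2 * e by rewrite mulr_ge0// exprn_ge0.
set X := 1 + n%:R^-1 *: G; set D := n%:R^-1 ^+ 2 *: E.
have Xx : rowsum_le X (1 + n%:R^-1 * g).
  apply: rowsum_leD; first exact: rowsum_le1.
  by have := rowsum_leZ n%:R^-1 Gg; rewrite ger0_norm.
have Dd : rowsum_le D (n%:R^-1 ^+ 2 * e).
  by have := rowsum_leZ (n%:R^-1 ^+ 2) Ee; rewrite ger0_norm// exprn_ge0.
have XD := rowsum_le_entry i j (rowsum_le_expB n (addr_ge0 ler01 ing) ie Xx Dd).
have XS := rowsum_le_entry i j (rowsum_le_euler_series n g0 Gg).
rewrite -/X in XS.
(* Only scalars remain. Both majorants subtract (1 + g/n)^n, whence the factor 2 in front of its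
   lower bound. *)
have up := expR_ge_euler n (addr_ge0 ing ie).
have lo := expR_le_euler n ing.
have pa := exp_partial_sum_le n.+1 g0.
have e1 : n%:R * (n%:R^-1 * g + n%:R^-1 ^+ 2 * e) = g + n%:R^-1 * e by field.
have e2 : n%:R * (n%:R^-1 * g / (1 + n%:R^-1 * g)) = g / (1 + n%:R^-1 * g).
  by rewrite !mulrA divff// mul1r.
rewrite e1 addrA in up; rewrite e2 in lo.
set S := \sum_(k < n.+1) _ in XS *; set P := (X + D) ^+ n in XD *.
have -> : S i j - P i j = (S - X ^+ n) i j - (P - X ^+ n) i j.
  by rewrite !mxE; ring.
apply: le_trans (ler_normB _ _) _.
apply: le_trans (lerD XS XD) _.
lra.
Qed.

End RowSumBound.

(** * Convergence of the series and of the Euler approximations *)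

Section MatrixExponential.
Variables (R : realType) (N : nat).
Implicit Types (X Y G E : 'M[R]_N).

Lemma cvg_mx (f : nat -> 'M[R]_N) (L : 'M[R]_N) :
  (forall i j, f n i j @[n --> \oo] --> L i j) -> f @ \oo --> L.
Proof.
move=> fL; apply/cvgrPdist_le => e e0.
have : \forall n \near \oo, forall ij : 'I_N * 'I_N,
    `|L ij.1 ij.2 - f n ij.1 ij.2| <= e.
  apply: filter_forall => -[i j] /=.
  by move/cvgrPdist_le: (fL i j); apply.
apply: filterS => n fn; rewrite [leLHS]/Num.norm /= mx_normrE.
apply: bigmax_le; first exact: ltW.
by move=> ij _; rewrite !mxE; exact: fn.
Qed.

(** The [limn] in [expmx] is informative only once convergence is known; each entry is dominated by
    the exponential series of a row-sum bound. *)
Lemma cvg_expmx_entry G i j :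
  (\sum_(k < n) (k`!%:R^-1 *: G ^+ k)) i j @[n --> \oo] --> expmx G i j.
Proof.
pose u k : 'M[R]_N := k`!%:R^-1 *: G ^+ k.
have uE i' j' n : (\sum_(k < n) u k) i' j' = series (fun k => u k i' j') n.
  by rewrite summxE seriesEord.
have [g g0 Gg] := rowsum_le_ex G.
have uC i' j' : cvgn (series (fun k => u k i' j')).
  apply: normed_cvg; apply: (@series_le_cvg _ _ (exp_coeff g)) => [k|k|k|].
  - exact: normr_ge0.
  - exact: exp_coeff_ge0.
  - have := rowsum_le_entry i' j' (rowsum_leX k g0 Gg).
    rewrite /= /u mxE normrM ger0_norm ?invr_ge0// mulrC.
    by rewrite /exp_coeff /= ler_pM2r ?invr_gt0 ?ltr0n ?fact_gt0.
  - exact: is_cvg_series_exp_coeff.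
pose L : 'M[R]_N := \matrix_(i, j) limn (series (fun k => u k i j)).
have uL : series u @ \oo --> L.
  apply: cvg_mx => i' j'; rewrite mxE.
  under eq_fun do rewrite seriesEord /= uE.
  exact: uC.
have -> : expmx G = L by apply: cvg_lim uL; exact: norm_hausdorff.
under eq_fun do rewrite uE.
by rewrite mxE; exact: uC.
Qed.

(** The second-order term [E] leaves room for the cross term of a product (1 + S/n)(1 + hM/n). *)
Lemma cvg_euler_expmx G E i j :
  ((1 + n%:R^-1 *: G + n%:R^-1 ^+ 2 *: E) ^+ n) i j @[n --> \oo] --> expmx G i
    j.
Proof.
have [g g0 Gg] := rowsum_le_ex G; have [e e0 Ee] := rowsum_le_ex E.
have := @cvg_expmx_entry G i j; rewrite -cvg_shiftS => Scv.
have inv0 : (n%:R^-1 : R) @[n --> \oo] --> (0 : R).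
  by rewrite -cvg_shiftS; exact: cvg_harmonic.
pose r n : R := expR (g + n%:R^-1 * e) + expR g - 2 * expR
  (g / (1 + n%:R^-1 * g)).
have r0 : r @ \oo --> (0 : R).
  have -> : (0 : R) = expR (g + 0 * e) + expR g - 2 * expR (g / (1 + 0 * g)).
    by rewrite !mul0r !addr0 divr1; ring.
  apply: cvgB; first apply: cvgD; last 2 first.
  - exact: cvg_cst.
  - apply: cvgMr; apply: (@cvg_comp _ _ _ _ expR); last exact: continuous_expR.
    apply: cvgMr; apply: cvgV; first by rewrite mul0r addr0 oner_neq0.
    by apply: cvgD; [exact: cvg_cst | apply: cvgMl].
  - apply: (@cvg_comp _ _ _ _ expR); last exact: continuous_expR.
    by apply: cvgD; [exact: cvg_cst | apply: cvgMl].
pose S n := (\sum_(k < n.+1) (k`!%:R^-1 *: G ^+ k)) i j.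
pose P n := ((1 + n%:R^-1 *: G + n%:R^-1 ^+ 2 *: E) ^+ n) i j.
have SP0 : (S n - P n) @[n --> \oo] --> (0 : R).
  apply: norm_cvg0; apply: (@squeeze_cvgr _ _ _ _ (cst 0) r) => //;
    last exact: cvg_cst.
  near=> n; rewrite normr_ge0 /=; apply: euler_entry_dist => //.
  by near: n; exists 1%N.
have -> : (fun n => ((1 + n%:R^-1 *: G + n%:R^-1 ^+ 2 *: E) ^+ n) i j) =
    (fun n => S n - (S n - P n)).
  by apply/funext => n; rewrite subKr.
rewrite -[expmx G i j]subr0; exact: cvgB.
Unshelve. all: by end_near. Qed.

(** Restricted to exponents 2^k, those of the trace inequalities above. *)
Definition euler2 G E k : 'M[R]_N :=
  (1 + (2 ^ k)%:R^-1 *: G + (2 ^ k)%:R^-1 ^+ 2 *: E) ^+ (2 ^ k).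

Lemma cvg_expn2 : (2 ^ k)%N @[k --> \oo] --> \oo.
Proof.
apply/cvgnyPge => A; near=> k.
by apply: leq_trans (ltnW (ltn_expl k (ltnSn 1))); near: k; exists A.
Unshelve. all: by end_near. Qed.

Lemma cvg_euler2_trace G E Y :
  \tr (euler2 G E k *m Y) @[k --> \oo] --> \tr (expmx G *m Y).
Proof.
have ent i j : euler2 G E k i j @[k --> \oo] --> expmx G i j.
  apply: (@cvg_comp _ _ _ (fun k => (2 ^ k)%N)
    (fun n => ((1 + n%:R^-1 *: G + n%:R^-1 ^+ 2 *: E) ^+ n) i j)).
    exact: cvg_expn2.
  exact: cvg_euler_expmx.
rewrite /mxtrace; under eq_fun do under eq_bigr do rewrite mxE.
under eq_bigr do rewrite mxE.
apply: cvg_big => [|i _]; first exact: add_continuous.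
apply: cvg_big => [|j _]; first exact: add_continuous.
by apply: cvgMl; exact: ent.
Qed.

End MatrixExponential.

(** * Traces of matrix exponentials *)

Section ExponentialTraceInequalities.
Variables (R : realType) (N : nat).
Implicit Types (H S M X Y E : 'M[R]_N).

Lemma cvg_euler2S_trace H E Y :
  \tr (euler2 H E k.+1 *m Y) @[k --> \oo] --> \tr (expmx H *m Y).
Proof. by rewrite (cvg_shiftS (fun k => \tr (euler2 H E k *m Y)));
  exact: cvg_euler2_trace. Qed.

(** An even power of a symmetric matrix is a Gram matrix, whatever the sign of its base; hence the
    shift to [k.+1] in the approximations. *)
Lemma exp2S_gram Z k : Z^T = Z -> 
  Z ^+ (2 ^ k.+1) = (Z ^+ (2 ^ k) *m (Z ^+ (2 ^ k))^T : 'M[R]_N).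
Proof.
by move=> ZT; rewrite trmxX ZT -[RHS]/(Z ^+ (2 ^ k) * Z ^+ (2 ^ k)) -exprD addnn -mul2n -expnS.
Qed.

Lemma euler2_base_tr H (c : R) : H^T = H -> (1 + c *: H)^T = 1 + c *: H.
Proof. by move=> HT; rewrite linearD /= trmx1 linearZ /= HT. Qed.

Lemma mxtrace_expmx_ge0 H Y : H^T = H -> psdmx Y -> 0 <= \tr (expmx H *m Y).
Proof.
move=> HT pY; apply: (cvgr_to_ge (@cvg_euler2S_trace H 0 Y)).
near=> k; rewrite /euler2 scaler0 addr0 exp2S_gram; last exact: euler2_base_tr.
exact: mxtrace_psd_gram.
Unshelve. all: by end_near. Qed.

(* Golden-Thompson, together with e^(hM) <= 1 + (e^h - 1) M; both are read off
   the Euler approximations (1 + H/n)^n with n = 2^k. *)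
Lemma mxtrace_expmxD_le S M (h : R) : S^T = S -> psdmx M -> psdmx (1%:M - M) ->
  0 <= h ->
  \tr (expmx (S + h *: M)) <= \tr (expmx S *m (1%:M + (expR h - 1) *: M)).
Proof.
move=> ST pM pM1 h0; rewrite -[expmx (S + _)]mulmx1.
(* This second-order term makes the Euler base factor exactly as (1 + cS)(1 + chM). *)
have cvl := @cvg_euler2S_trace (S + h *: M) (S *m (h *: M)) 1%:M.
have cvr := @cvg_euler2S_trace S 0 (1%:M + (expR h - 1) *: M).
apply: (ler_cvg_to cvl cvr); near=> k.
set c : R := (2 ^ k.+1)%:R^-1.
have n0 : (0 < 2 ^ k.+1)%N by rewrite expn_gt0.
have c0 : 0 <= c by rewrite invr_ge0.
set X := 1 + c *: S; set Y := 1 + (c * h) *: M.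
have XT : X^T = X by exact: euler2_base_tr.
have YT : Y^T = Y by apply: euler2_base_tr; exact: psdmx_sym.
have -> : euler2 (S + h *: M) (S *m (h *: M)) k.+1 = (X *m Y) ^+ (2 ^ k.+1).
  rewrite /euler2 -/c; congr (_ ^+ _).
  rewrite /X /Y mulmxDl !mulmxDr !mul1mx mulmx1.
  rewrite -scalemxAl -[_ *m ((c * h) *: M)]scalemxAr -scalemxAr !scalerA
    scalerDr scalerA.
  rewrite expr2 -!addrA; congr (_ + _).
  by rewrite addrCA addrA mulrA -!addrA addrCA.
have -> : euler2 S 0 k.+1 = X ^+ (2 ^ k.+1) by rewrite /euler2 scaler0 addr0.
rewrite mulmx1; apply: le_trans ((mxtrace_exp2_le R N _).1 _ _ XT YT) _.
rewrite -subr_ge0 -raddfB /= -mulmxBr exp2S_gram//; apply: mxtrace_psd_gram.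
have ch0 : 0 <= c * h by rewrite mulr_ge0.
(* It remains to bound Y^n by 1 + (e^h - 1) M: the binomial bound gives (1 + ch)^n in place of e^h,
   and (1 + ch)^n <= e^h since c = 1/n. *)
have pB := psdmx_binomial (2 ^ k.+1) pM pM1 ch0.
have le : (1 + c * h) ^+ (2 ^ k.+1) <= expR h.
  apply: le_trans (expR_ge_euler _ ch0) _.
  by rewrite mulrA divff ?mul1r// pnatr_eq0 -lt0n.
rewrite -subr_ge0 in le.
have := psdmxD pB (psdmxZ le pM); rewrite -/Y.
congr (psdmx _).
by apply/matrixP => i j; rewrite !mxE; ring.
Unshelve. all: by end_near. Qed.

(** With Y = 1 + H/n and mu = tr(HX), (1 + mu/n)^n = tr(YX)^n <= tr(Y^n X) <= tr(Y^n) for n =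
    2^(k+1); then n tends to infinity. *)
Lemma mxtrace_expmx_ge H X : H^T = H -> psdmx X -> \tr X = 1 ->
  0 <= \tr (H *m X) -> expR (\tr (H *m X)) <= \tr (expmx H).
Proof.
move=> HT pX X1; set mu := \tr _ => mu0; rewrite -[expmx H]mulmx1.
pose f n : R := expR (mu / (1 + n%:R^-1 * mu)).
have cvf : f n @[n --> \oo] --> expR mu.
  have -> : expR mu = expR (mu / (1 + 0 * mu)) by rewrite mul0r addr0 divr1.
  apply: (@cvg_comp _ _ _ _ expR); last exact: continuous_expR.
  apply: cvgMr; apply: cvgV; first by rewrite mul0r addr0 oner_neq0.
  apply: cvgD; [exact: cvg_cst | apply: cvgMl].
  by rewrite -cvg_shiftS; exact: cvg_harmonic.
have cvf2 : f (2 ^ k)%N @[k --> \oo] --> expR mu by exact: cvg_comp cvg_expn2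
  cvf.
have := cvf2; rewrite -cvg_shiftS => cvf2S.
apply: (ler_cvg_to cvf2S (@cvg_euler2S_trace H 0 1%:M)); near=> k.
set c : R := (2 ^ k.+1)%:R^-1.
have n0 : (0 < 2 ^ k.+1)%N by rewrite expn_gt0.
have c0 : 0 <= c by rewrite invr_ge0.
set Y := 1 + c *: H.
have YT : Y^T = Y by exact: euler2_base_tr.
have -> : euler2 H 0 k.+1 = Y ^+ (2 ^ k.+1) by rewrite /euler2 scaler0 addr0.
have YX : \tr (Y *m X) = 1 + c * mu.
  by rewrite mulmxDl mul1mx -scalemxAl raddfD /= linearZ /= X1.
have cm : 0 <= c * mu by rewrite mulr_ge0.
apply: (@le_trans _ _ (\tr (Y *m X) ^+ (2 ^ k.+1))).
  rewrite YX; apply: le_trans (expR_le_euler _ cm).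
  by rewrite /f -/c ler_expR !mulrA divff ?mul1r// pnatr_eq0 -lt0n.
apply: le_trans (mxtrace_exp_density _ YT pX X1 _) _;
  first by rewrite YX addr_ge0.
rewrite mulmx1 exp2S_gram//; apply: le_trans (mxtrace_gram_le _ pX) _.
by rewrite X1 mulr1.
Unshelve. all: by end_near. Qed.

Lemma expmx0 : expmx (0 : 'M[R]_N) = 1%:M.
Proof.
apply/matrixP => i j.
have := @cvg_euler_expmx _ _ (0 : 'M[R]_N) 0 i j.
under eq_fun do rewrite !scaler0 !addr0 expr1n.
by move/(cvg_unique (@Rhausdorff R)) => /(_ _ (@cvg_cst _ _ _ _ _)).
Qed.

(** Apply the previous lower bound to the density matrix I/N. *)
Lemma mxtrace_expmx_gt0 H : (0 < N)%N -> psdmx H -> 0 < \tr (expmx H).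
Proof.
move=> N0 pH; have N0R : (N%:R : R) != 0 by rewrite pnatr_eq0 -lt0n.
pose X : 'M[R]_N := N%:R^-1 *: 1%:M.
have pX : psdmx X by apply: psdmxZ (psdmx1 _ _); rewrite invr_ge0.
have X1 : \tr X = 1 by rewrite linearZ /= mxtrace1 mulVf.
have HX : 0 <= \tr (H *m X).
  by rewrite -scalemxAr mulmx1 linearZ /= mulr_ge0 ?invr_ge0 ?psdmx_trace_ge0.
exact: lt_le_trans (expR_gt0 _) (mxtrace_expmx_ge (psdmx_sym pH) pX X1 HX).
Qed.

(* Comparing the exponential growth rates in t of the bounds
   e^(t tr(M X)) <= tr e^(tM) <= N e^t. *)
Lemma mxtrace_density_le1 M X : (0 < N)%N -> psdmx M -> psdmx (1%:M - M) ->
  psdmx X -> \tr X = 1 -> \tr (M *m X) <= 1.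
Proof.
move=> N0 pM pM1 pX X1; rewrite leNgt; apply/negP; set mu := \tr _ => mu1.
have NR : (0 : R) < N%:R by rewrite ltr0n.
have lnN0 : 0 <= ln (N%:R : R) by rewrite ln_ge0// ler1n.
(* Chosen so that t mu = ln N + 1 + t, which exceeds the exponent ln N + t of the upper bound N
   e^t. *)
pose t := (ln N%:R + 1) / (mu - 1).
have t0 : 0 <= t by apply: divr_ge0; lra.
have tmu : t * mu = ln N%:R + 1 + t by rewrite /t; field;
  rewrite subr_eq0 gt_eqF.
have tMX : \tr ((t *: M) *m X) = t * mu by rewrite -scalemxAl linearZ.
have := @mxtrace_expmxD_le 0 M t (trmx0 _ _ _) pM pM1 t0.
have /mxtrace_expmx_ge := psdmx_sym (psdmxZ t0 pM) => /(_ _ pX X1).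
rewrite tMX tmu add0r expmx0 mul1mx => /(_ _) lo up.
have {lo} : expR (ln N%:R + 1 + t) <= \tr (expmx (t *: M)).
  by apply: lo; rewrite !addr_ge0.
move=> /le_trans/(_ up); rewrite raddfD /= linearZ /= mxtrace1.
have trM : \tr M <= N%:R.
  by have := psdmx_trace_ge0 pM1; rewrite raddfB /= mxtrace1 subr_ge0.
have et1 : 0 <= expR t - 1 by rewrite subr_ge0 -expR0 ler_expR.
move=> /le_trans/(_ (lerD (lexx _) (ler_wpM2l et1 trM))).
have -> : N%:R + (expR t - 1) * N%:R = expR (ln N%:R + t).
  by rewrite expRD lnK ?posrE//; ring.
by rewrite ler_expR; lra.
Qed.

End ExponentialTraceInequalities.

(** From (1 - x/3)^3 <= e^(-x), it suffices that (1 - x/3)^3 (1 + x + x^2) > 1. Strictness is used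
    at the end of the loop analysis. *)
Lemma expR_lt_quadratic (R : realType) (x : R) : 0 < x -> x < 2^-1 ->
  expR x < 1 + x + x ^+ 2.
Proof.
move=> x0 x12; have h : 1 - x / 3 <= expR (- (x / 3)) by exact: expR_ge1Dx.
have p0 : 0 < 1 - x / 3 by lra.
have h3 : (1 - x / 3) ^+ 3 * expR x <= 1.
  apply: (@le_trans _ _ (expR (- (x / 3)) ^+ 3 * expR x)).
    by rewrite ler_wpM2r ?expR_ge0// lerXn2r ?nnegrE ?expR_ge0// ltW.
  by rewrite -expRM_natl -expRD -[leRHS]expR0 ler_expR; lra.
rewrite -(ltr_pM2l (exprn_gt0 3 p0)); apply: le_lt_trans h3 _.
have -> : (1 - x / 3) ^+ 3 * (1 + x + x ^+ 2) =
  1 + x ^+ 2 * (9 - 19 * x + 8 * x ^+ 2 - x ^+ 3) / 27 by field.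
rewrite ltrDl divr_gt0// mulr_gt0 ?exprn_gt0//.
have : x ^+ 3 <= x ^+ 2 by rewrite exprS ler_piMl ?exprn_ge0; lra.
have : 0 <= (x - 2^-1) ^+ 2 by exact: sqr_ge0.
nra.
Qed.

Lemma loop_count_ge (R : realType) (x : R) : x <= (loop_count x)%:R.
Proof.
rewrite /loop_count natr_absz; apply: le_trans (ceil_ge x) _.
by rewrite ler_int ger0_norm ?le_max ?lexx ?orbT.
Qed.

(** * The algorithms *)

Section HamiltonianUpdatesRuns.
Variables (R : realType) (N : nat) (eps : R) (cs : seq ('M[R]_N * R)).
Hypothesis N_gt1 : (1 < N)%N.
Hypothesis eps_gt0 : 0 < eps.
Hypothesis cs_bnd : forall c, c \in cs -> psdmx (1%:M + c.1) /\ psdmx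
  (1%:M - c.1).

Let h := eps / 4.

Let N_gt0 : (0 < N)%N. Proof. exact: ltnW. Qed.

Let h_gt0 : 0 < h. Proof. by rewrite divr_gt0. Qed.

Lemma update_psd c : c \in cs -> psdmx (2^-1 *: (1%:M - c.1)) /\
  psdmx (1%:M - 2^-1 *: (1%:M - c.1)).
Proof.
move=> /cs_bnd[pp pm]; split; first by apply: psdmxZ; rewrite ?invr_ge0.
have := psdmxZ (_ : 0 <= 2^-1 :> R) pp; rewrite invr_ge0 => /(_ (ler0n _ _)).
by congr (psdmx _); apply/matrixP => i j; rewrite !mxE; field.
Qed.

(** The normalized weight is described by its pairings with positive semidefinite matrices, the form
    in which weak duality uses it. *)
Lemma hu_stop_solution n W S : W = expmx (h *: S) -> psdmx S ->
  hu_run eps cs n W S true ->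
  exists2 P : 'M[R]_N, \tr P = 1 /\ (forall Y, psdmx Y -> 0 <= \tr (P *m Y)) &
    forall c, c \in cs -> \tr (P *m c.1) <= c.2 + eps.
Proof.
move=> WE pS; move Eeta : true => eta run.
elim: run WE pS Eeta => [//|{}n {}W {}S ok WE pS _|{}n {}W {}S c {}eta cin _ S' _ IH WE pS Eeta].
  have phS : psdmx (h *: S) by apply: psdmxZ pS; exact: ltW.
  have trW : 0 < \tr W by rewrite WE mxtrace_expmx_gt0.
  exists (normalize_tr W); last first.
    by move=> c cin; rewrite mxtrace_mulC leNgt; apply/negP; exact: ok.
  split=> [|Y pY]; first by rewrite linearZ /= mulVf ?gt_eqF.
  rewrite -scalemxAl linearZ /= mulr_ge0 ?invr_ge0 ?(ltW trW)//.
  by rewrite WE mxtrace_expmx_ge0// psdmx_sym.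
by apply: IH => //; apply: psdmxD pS _; exact: (update_psd cin).1.
Qed.

Variable X : 'M[R]_N.
Hypotheses (pX : psdmx X) (X1 : \tr X = 1).
Hypothesis X_sol : forall c, c \in cs -> \tr (c.1 *m X) <= c.2.

(* p is the loss of the algorithm after s updates, the sum of the tr(M P) over
   them; the loss of X is at least eps / 2 larger at each update. *)
Definition hu_invariant (s : nat) (p : R) (W S : 'M[R]_N) : Prop :=
  [/\ W = expmx (h *: S), psdmx S, 0 <= p <= s%:R,
      \tr W <= N%:R * expR ((expR h - 1) * p) &
      p + s%:R * (eps / 2) <= \tr (S *m X)] /\ ((0 < s)%N -> eps < 2).

Lemma hu_invariant_init : hu_invariant 0 0 1%:M 0.
Proof.
split=> //; split; first by rewrite scaler0 expmx0.
- exact: psdmx0.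
- by rewrite !lexx.
- by rewrite mulr0 expR0 mulr1 mxtrace1.
- by rewrite mul0mx mxtrace0 mul0r addr0.
Qed.

Lemma hu_invariant_gt0 s p W S : hu_invariant s p W S -> 0 < \tr W.
Proof.
case=> -[-> pS _ _ _] _; apply: mxtrace_expmx_gt0 => //.
by apply: psdmxZ pS; exact: ltW.
Qed.

Lemma hu_invariant_update s p W S c : hu_invariant s p W S ->
  c \in cs -> violated eps c (normalize_tr W) ->
  let S' := S + 2^-1 *: (1%:M - c.1) in
  exists p', hu_invariant s.+1 p' (expmx (h *: S')) S'.
Proof.
move=> inv cin viol S'; have trW := hu_invariant_gt0 inv.
case: inv => -[WE pS /andP[p0 ps] Wle Xge] _.
have [] := update_psd cin; rewrite {}/S'; set M := 2^-1 *: _ => pM pM1.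
have phS : psdmx (h *: S) by apply: psdmxZ pS; exact: ltW.
have hST := psdmx_sym phS.
pose q := \tr (W *m M) / \tr W.
have WM0 : 0 <= \tr (W *m M) by rewrite WE mxtrace_expmx_ge0.
have WM1 : \tr (W *m M) <= \tr W.
  have := mxtrace_expmx_ge0 hST pM1.
  by rewrite -WE mulmxBr mulmx1 raddfB /= subr_ge0.
have q0 : 0 <= q by rewrite divr_ge0 // ltW.
have q1 : q <= 1 by rewrite ler_pdivrMr// mul1r.
(* [q] is tr(MP), and tr(MX) - tr(MP) is half of tr(A'P) - tr(A'X), which exceeds (b' + eps) -
   b'. *)
have qX : q + eps / 2 < \tr (M *m X).
  have -> : q = 2^-1 * (1 - \tr (c.1 *m normalize_tr W)).
    rewrite /q /M /normalize_tr -!scalemxAr mulmxBr mulmx1 linearZ /= raddfB /=.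
    rewrite linearZ /= (mxtrace_mulC W); field.
    exact: lt0r_neq0.
  rewrite /M -scalemxAl mxtraceZ mulmxBl mul1mx raddfB /= X1.
  by have := X_sol cin; move: viol; rewrite /violated; lra.
have X_le1 := mxtrace_density_le1 N_gt0 pM pM1 pX X1.
(* An update forces eps / 2 < tr(MX) <= 1, that is eps < 2; this puts [h] below 1/2, the range of
   the quadratic bound. *)
exists (p + q); split; last by move=> _; lra.
split=> //.
- exact: psdmxD.
- by rewrite addr_ge0//= -natr1 lerD.
- rewrite scalerDr; apply: le_trans (mxtrace_expmxD_le hST pM pM1 (ltW h_gt0)) _.
  rewrite -WE mulmxDr mulmx1 -scalemxAr raddfD /= linearZ /=.
  have -> : \tr W + (expR h - 1) * \tr (W *m M) = \tr W *
    (1 + (expR h - 1) * q).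
    by rewrite /q; field; exact: lt0r_neq0.
  have eh : 0 <= expR h - 1 by rewrite subr_ge0 -[leLHS]expR0 ler_expR ltW.
  rewrite [_ * (p + q)]mulrDr expRD mulrA; apply: ler_pM => //;
    [exact: ltW | | exact: expR_ge1Dx].
  by rewrite addr_ge0// mulr_ge0.
- by rewrite mulmxDl raddfD /= -natr1; lra.
Qed.

Lemma hu_complete_invariant n s p W S : hu_invariant s p W S ->
  hu_run eps cs n W S false -> exists p' W' S', hu_invariant (s + n) p' W' S'.
Proof.
move=> inv; move Eeta : false => eta run.
elim: run s p inv Eeta => [{}W {}S s p inv _|//|{}n {}W {}S c {}eta cin viol S' _ IH s p inv Eeta].
  by exists p, W, S; rewrite addn0.
have [p' inv'] := hu_invariant_update inv cin viol.
by rewrite -addSnnS; exact: IH inv' Eeta.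
Qed.

(** After T updates, e^(h tr(SX)) <= tr W <= N e^((e^h - 1) p), while the invariant makes tr(SX) too
    large for this. *)
Lemma hamiltonian_updates_feasible : ~ hamiltonian_updates eps cs false.
Proof.
set T := loop_count (16 * ln N%:R / eps ^+ 2).
move=> /(hu_complete_invariant hu_invariant_init)[p [W [S]]].
rewrite add0n -/T => -[[WE pS /andP[p0 pT] Wle Xge] eps2].
have NR1 : (1 : R) < N%:R by rewrite ltr1n.
have NR0 : (0 : R) < N%:R by exact: lt_trans NR1.
have lnN0 : 0 < ln (N%:R : R) by rewrite ln_gt0.
have Tge : 16 * ln N%:R / eps ^+ 2 <= T%:R := loop_count_ge _.
have eps20 : 0 < eps ^+ 2 by rewrite exprn_gt0.
have T0 : 0 < (T%:R : R).
  by apply: lt_le_trans Tge; rewrite divr_gt0// mulr_gt0.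
(* N > 1 makes T positive, so at least one update took place. *)
have {}eps2 : eps < 2 by apply: eps2; rewrite -(ltr0n R).
have lnN_le : ln N%:R <= h ^+ 2 * T%:R.
  by move: Tge; rewrite ler_pdivrMr// /h; lra.
have h12 : h < 2^-1 by rewrite /h; lra.
have quad := expR_lt_quadratic h_gt0 h12.
have mu0 : 0 <= \tr ((h *: S) *m X).
  rewrite -scalemxAl linearZ /= mulr_ge0 ?(ltW h_gt0)//; apply: le_trans Xge.
  by rewrite addr_ge0// mulr_ge0 ?divr_ge0// ltW.
have phS : psdmx (h *: S) by apply: psdmxZ pS; exact: ltW.
have := mxtrace_expmx_ge (psdmx_sym phS) pX X1 mu0.
rewrite -WE => /le_trans/(_ Wle).
rewrite -[X in X * expR _]lnK ?posrE// -expRD ler_expR -scalemxAl linearZ /=.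
have := ler_wpM2l (ltW h_gt0) Xge.
have -> : eps = 4 * h by rewrite /h; field.
have pd : p * (expR h - (1 + h + h ^+ 2)) <= 0.
  by rewrite mulr_ge0_le0// subr_le0 ltW.
have pT2 : 0 <= h ^+ 2 * (T%:R - p) by rewrite mulr_ge0 ?exprn_ge0 ?subr_ge0//
  ltW.
have hT : 0 < h ^+ 2 * T%:R by rewrite mulr_gt0// exprn_gt0.
(* The bounds read hp + 2 h^2 T <= ln N + (e^h - 1) p, with ln N <= h^2 T and p <= T. The
   contradiction comes from the strict quadratic bound if p > 0, and from h^2 T > 0 if p = 0. *)
have [p_gt0|p_le0] := ltP 0 p.
  have : p * (expR h - (1 + h + h ^+ 2)) < 0 by rewrite pmulr_rlt0// subr_lt0.
  lra.
have -> : p = 0 by apply/eqP; rewrite eq_le p_le0 p0.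
lra.
Qed.

End HamiltonianUpdatesRuns.

(** * Runs of the binary search *)

Section BinarySearchRuns.
Variables (R : realType) (N M : nat) (eps : R).
Variables (C : 'M[R]_N) (A : 'I_M -> 'M[R]_N) (b : 'cV[R]_M).
Hypothesis N_gt1 : (1 < N)%N.
Hypothesis eps_gt0 : 0 < eps.
Hypothesis C_bnd : loewner_le (- 1%:M) C /\ loewner_le C 1%:M.
Hypothesis A_bnd : forall i, loewner_le (- 1%:M) (A i) /\ loewner_le (A i) 1%:M.

Lemma bs_constraintsP lambda (P : 'M[R]_N * R -> Prop) :
  (forall c, c \in bs_constraints C A b lambda -> P c) <->
  [/\ forall i, P (A i, b i 0), forall i, P (- A i, - b i 0) & P (C, lambda)].
Proof.
split=> [Pc|[PA PN PC] c].
  split=> [i|i|]; apply: Pc; rewrite !mem_cat; apply/or3P.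
  - by apply: Or31; apply/mapP; exists i; rewrite ?mem_enum.
  - by apply: Or32; apply/mapP; exists i; rewrite ?mem_enum.
  - by apply: Or33; rewrite mem_head.
rewrite !mem_cat => /or3P[/mapP[i _ ->]|/mapP[i _ ->]|]//.
by rewrite inE => /eqP ->.
Qed.

Lemma bs_constraints_bnd lambda c : c \in bs_constraints C A b lambda ->
  psdmx (1%:M + c.1) /\ psdmx (1%:M - c.1).
Proof.
move: c; apply/bs_constraintsP.
have bnd (Y : 'M[R]_N) : loewner_le (- 1%:M) Y /\ loewner_le Y 1%:M ->
    psdmx (1%:M + Y) /\ psdmx (1%:M - Y).
  by rewrite /loewner_le opprK [Y + _]addrC.
split=> [i|i|] /=; [exact: bnd | | exact: bnd].
by rewrite opprK; have [] := bnd _ (A_bnd i).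
Qed.

Lemma hu_infeasible_lt X lambda : psdmx X -> \tr X = 1 ->
  (forall i, \tr (A i *m X) = b i 0) ->
  hamiltonian_updates eps (bs_constraints C A b lambda) false ->
  lambda < \tr (C *m X).
Proof.
move=> pX X1 AX run; rewrite ltNge; apply/negP => CX.
apply: (hamiltonian_updates_feasible N_gt1 eps_gt0 (@bs_constraints_bnd lambda) pX X1 _ run).
apply/bs_constraintsP; split=> [i|i|] //=; first by rewrite AX.
by rewrite mulNmx raddfN /= AX.
Qed.

(* Weak duality, the constraints being violated by at most eps. *)
Lemma hu_feasible_ge (xi : 'cV[R]_M) lambda : psdmx (C - \sum_i xi i 0 *: A i)
  ->
  hamiltonian_updates eps (bs_constraints C A b lambda) true ->
  (b^T *m xi) 0 0 <= lambda + eps * (1 + norm1 xi).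
Proof.
move=> pC run.
have W1 : 1%:M = expmx ((eps / 4) *: (0 : 'M[R]_N)) by rewrite scaler0 expmx0.
have [P [P1 P0]] := hu_stop_solution N_gt1 eps_gt0 (@bs_constraints_bnd lambda)
  W1 (psdmx0 R N) run.
move=> /bs_constraintsP[/= PA PN PC].
have := P0 _ pC; rewrite mulmxBr raddfB /= subr_ge0 mulmx_sumr raddf_sum /= => dual.
have : (b^T *m xi) 0 0 - eps * norm1 xi <= \tr (P *m C).
  apply: le_trans dual; rewrite mxE /norm1 mulr_sumr -sumrB.
  apply: ler_sum => i _; rewrite mxE -scalemxAr mxtraceZ.
  have := PN i; rewrite mulmxN raddfN /= => PNi.
  (* The constraints for [A i] and [- A i] together give a two-sided bound, whatever the sign of
     [xi i 0]. *)
  have d : `|b i 0 - \tr (P *m A i)| <= eps.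
    by have := PA i; rewrite ler_norml; lra.
  rewrite lerBlDl -lerBlDr [b i 0 * _]mulrC -mulrBr.
  apply: le_trans (ler_norm _) _.
  by rewrite normrM mulrC ler_wpM2r.
lra.
Qed.

(** The lower end is always exact, while the upper end carries a slack. The slack does not
    accumulate: each stopped call bounds the optimum afresh at its own midpoint. *)
Lemma bs_run_bounds X (xi : 'cV[R]_M) n lo hi out : psdmx X -> \tr X = 1 ->
  (forall i, \tr (A i *m X) = b i 0) ->
  psdmx (C - \sum_i xi i 0 *: A i) -> (b^T *m xi) 0 0 = \tr (C *m X) ->
  lo <= \tr (C *m X) <= hi + eps * (1 + norm1 xi) ->
  bs_run eps C A b n lo hi out ->
  out <= \tr (C *m X) <= out + (hi - lo) / 2 ^+ n + eps * (1 + norm1 xi).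
Proof.
move=> pX X1 AX pC bxi + run.
elim: run => [{}lo {}hi /andP[lo_le hi_ge]|{}n {}lo {}hi eta {}out mid hu _ IH /andP[lo_le hi_ge]].
  by rewrite lo_le expr0 divr1 /=; lra.
have half : (hi - mid = (hi - lo) / 2) /\ (mid - lo = (hi - lo) / 2).
  by rewrite /mid; split; field.
have step : (hi - lo) / 2 ^+ n.+1 = (hi - lo) / 2 / 2 ^+ n by rewrite exprS
  invfM mulrA.
rewrite step; case: eta hu IH => hu IH.
  rewrite -half.2; apply: IH; rewrite lo_le -bxi; exact: hu_feasible_ge.
rewrite -half.1; apply: IH; rewrite hi_ge andbT ltW//;
  exact: hu_infeasible_lt hu.
Qed.

End BinarySearchRuns.

Lemma loop_count_log2 (R : realType) (q : R) :
  0 < q -> q <= 2 ^+ (loop_count (ln q / ln 2)).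
Proof.
move=> q0; have ln2 : 0 < ln (2 : R) by rewrite ln_gt0// ltr1n.
have := loop_count_ge (ln q / ln 2); rewrite ler_pdivrMr// mulr_natl.
by rewrite -lnXn// ler_ln ?posrE ?exprn_gt0.
Qed.

Theorem lemma14 (R : realType) (N M : nat) (eps : R)
    (C : 'M[R]_N) (A : 'I_M -> 'M[R]_N) (b : 'cV[R]_M)
    (lstar lmin lmax : R) (xistar : 'cV[R]_M) (lT : R)
    (N_gt1 : (1 < N)%N)
    (eps_gt0 : 0 < eps)
    (C_sym : C \is symmetricmx)
    (A_sym : forall i, A i \is symmetricmx)
    (C_bnd : loewner_le (- 1%:M) C /\ loewner_le C 1%:M)
    (A_bnd : forall i, loewner_le (- 1%:M) (A i) /\ loewner_le (A i) 1%:M)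
    (sdp_sol : exists X, min_solution C (primal_feasible_tr1 A b) X)
    (lstarE : lstar%:E = min_value C (primal_feasible_tr1 A b))
    (lmin_lt_lmax : lmin < lmax)
    (lstar_itv : lmin <= lstar <= lmax)
    (lstarE_no_tr : lstar%:E = min_value C (primal_feasible A b))
    (sd : strong_duality C A b)
    (xistar_sol : dual_solution C A b xistar)
    (lT_out : binary_search eps C A b lmin lmax lT) :
  0 <= lstar - lT <= eps * (2 + norm1 xistar).
Proof.
have [X [[[pX AX] X1] Xmin]] := sdp_sol.
have CX : \tr (C *m X) = lstar by move: Xmin; rewrite -lstarE => -[].
have [pC bxi] := xistar_sol.
(* The dual belongs to the problem without the trace constraint; equality of the two primal values
   transfers it to [X]. *)
have bxiX : (b^T *m xistar) 0 0 = \tr (C *m X).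
  by case: sd => vals _ _; move: bxi; rewrite -vals -lstarE_no_tr CX => -[].
have norm0 : 0 <= norm1 xistar by exact: sumr_ge0.
have slack : 0 <= eps * (1 + norm1 xistar) by rewrite mulr_ge0 ?(ltW eps_gt0)//
  addr_ge0.
have lstar_bnd : lmin <= \tr (C *m X) <= lmax + eps * (1 + norm1 xistar).
  by case/andP: lstar_itv => lmin_le lmax_ge; rewrite CX lmin_le /=; lra.
have := bs_run_bounds N_gt1 eps_gt0 C_bnd A_bnd pX X1 AX pC bxiX lstar_bnd
  lT_out.
rewrite CX => /andP[lT_le lT_ge].
have len0 : 0 < (lmax - lmin) / eps by rewrite divr_gt0// subr_gt0.
have := loop_count_log2 len0; set k := loop_count _ in lT_ge *.
have k0 : 0 < (2 : R) ^+ k by rewrite exprn_gt0.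
rewrite ler_pdivrMr// => len_le.
(* The final interval adds one [eps] to the slack eps (1 + |xi|_1), giving the constant 2. *)
have gap : (lmax - lmin) / 2 ^+ k <= eps by rewrite ler_pdivrMr// mulrC.
have := le_trans lT_ge (lerD (lerD (lexx _) gap) (lexx _)).
by rewrite subr_ge0 lT_le /= -addrA -lerBlDl mulrDr -[2]/(1 + 1) !mulrDr mulr1
  addrA.
Qed.
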